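(* Let $E$ be a sequence space. Let $(T_t)_{t\in(0,\infty)}$ be a positive one-parameter semigroup of sequentially order continuous operators on $E$ such that $t\mapsto (T_te^i)_j$ is continuous on $(0,\infty)$ for all $i,j\in\mathbb{N}$. Then for all $i,j\in\mathbb{N}$, either $(T_te^i)_j>0$ for all $t>0$, or $(T_te^i)_j=0$ for all $t>0$.
   Context: Let $\ell^0$ be the vector lattice of all real sequences $(x_n)_{n\in\mathbb{N}}$ with the component-wise ordering. For $k\in\mathbb{N}$ let $e^k=(\mathbf{1}_{\{k\}}(n))_{n\in\mathbb{N}}$ be the $k$-th unit vector. A sequence space is a sublattice of $\ell^0$ (a linear subspace closed under the lattice operations of $\ell^0$) that contains all unit vectors $e^k$, $k\in\mathbb{N}$. For a sequence space $E$ let $E_+=\{x\in E: x_n\ge 0 \text{ for all } n\in\mathbb{N}\}$. A linear operator $T\colon E\to E$ is positive if $TE_+\subseteq E_+$. A sequence $(x^k)\subseteq E$ is order convergent to $x\in E$ if it is order bounded in $E$ (i.e. there is $y\in E$ with $|x^k|\le y$ for all $k$) and $x^k_n\to x_n$ as $k\to\infty$ for all $n\in\mathbb{N}$. A linear operator $T\colon E\to E$ is sequentially order continuous if $(Tx^k)$ is order convergent to $Tx$ whenever $(x^k)$ is order convergent to $x$ in $E$. A family of linear operators $(T_t)_{t\in(0,\infty)}$ on a vector space is a (one-parameter operator) semigroup if $T_{t+s}=T_tT_s$ for all $t,s>0$; it is positive if every $T_t$ is positive. *)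

(* Defs.v *)
From HB Require Import structures.
From mathcomp Require Import all_boot all_order all_algebra.
From mathcomp Require Import all_classical all_reals all_analysis.

Set Implicit Arguments.
Unset Strict Implicit.
Unset Printing Implicit Defensive.

Import Order.TTheory GRing.Theory Num.Theory.
Import numFieldNormedType.Exports.

Local Open Scope classical_set_scope.
Local Open Scope ring_scope.

Definition unit_vector (R : realType) (k : nat) : nat -> R := \1_[set k].

(* The ambient space [nat -> R] carries the library's componentwise lattice
   order ([FunOrder] in boolp), so [Order.LatticeClosed] means closed under the
   componentwise minimum and maximum of two sequences. *)
HB.mixin Record hasUnitVectors (R : realType) (E : {pred (nat -> R)}) := {
  unit_vector_mem : forall k, unit_vector R k \in E
}.

#[short(type="sequenceSpace")]
HB.structure Definition SequenceSpace (R : realType) :=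
  {E of @GRing.SubmodClosed R (nat -> R) E
      & @Order.LatticeClosed _ (nat -> R) E
      & hasUnitVectors R E}.

(* [elt E] is the sequence space [E] regarded as a real vector space. *)
Record elt (R : realType) (E : sequenceSpace R) := Elt {
  elt_val :> nat -> R;
  elt_mem : elt_val \in (E : {pred (nat -> R)})
}.

HB.instance Definition _ (R : realType) (E : sequenceSpace R) :=
  [isSub for @elt_val R E].
HB.instance Definition _ (R : realType) (E : sequenceSpace R) :=
  [Choice of elt E by <:].
HB.instance Definition _ (R : realType) (E : sequenceSpace R) :=
  [SubChoice_isSubLmodule of elt E by <:].

Definition unit_elt (R : realType) (E : sequenceSpace R) (k : nat) : elt E :=
  Elt (@unit_vector_mem R E k).

Section Operators.
Context (R : realType) (E : sequenceSpace R).

Definition positive_operator (T : {linear elt E -> elt E}) : Prop :=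
  forall x : elt E, (forall n, 0 <= x n) -> forall n, 0 <= T x n.

Definition order_bounded (x : nat -> elt E) : Prop :=
  exists y : elt E, forall k n, `|x k n| <= y n.

Definition order_convergent (x : nat -> elt E) (l : elt E) : Prop :=
  order_bounded x /\ forall n, x k n @[k --> \oo] --> l n.

Definition seq_order_continuous (T : {linear elt E -> elt E}) : Prop :=
  forall (x : nat -> elt E) (l : elt E),
    order_convergent x l -> order_convergent (fun k => T (x k)) (T l).

End Operators.

(* Families indexed by (0, oo) are functions on [R]; their values at [t <= 0]
   are irrelevant. *)
Definition operator_semigroup (R : realType) (V : lmodType R)
    (T : R -> {linear V -> V}) : Prop :=
  forall t s, 0 < t -> 0 < s -> T (t + s) =1 T t \o T s.

(* Main.v *)
Require Import Defs.
From HB Require Import structures.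
From mathcomp Require Import all_boot all_order all_algebra.
From mathcomp Require Import all_classical all_reals all_analysis.
From mathcomp Require Import ring lra.
Import Order.TTheory GRing.Theory Num.Theory.
Import numFieldNormedType.Exports.
Local Open Scope classical_set_scope.
Local Open Scope ring_scope.

(** Write [p t i j] for [T t (unit_elt E i) j]. Sequential order continuity
applied to the truncations of [T s (unit_elt E i)] turns the semigroup law into
matrix multiplication, [p (s + t) i j = \sum_k p s i k * p t k j], so the claim
is about nonnegative matrix semigroups with continuous entries
([continuous_matrix_semigroup]).

Fix T with [p T i j > 0]. For each s in (0, T) the numbers
[p s i k * p (T - s) k j] are the masses of a finite measure on the states k
whose total [p T i j] does not depend on s: up to normalisation, the law at time
s of a random path from i to j of length T. The masses are continuous in s and so
is their sum, whence, as in Dini's theorem, finitely many states carry all but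
[e] of the mass simultaneously for all s in a compact interval
([uniform_mean_tail]). A function b of the state takes only finitely many values
on these states. Comparing times s and s + h, this has two effects, on averages
along the path.
- If b can grow by at most h during a time h, it does not grow at all: for small
  h, growth between two of the finitely many states would need a jump of b below
  the smallest gap between its values there ([mean_nonincreasing]).
- If b strictly grows in every time step, it grows by at least this gap with
  mass bounded below, however short the step, so it is unbounded
  along the path ([strictly_increasing_unbounded]).

Let P(i, j) be the open set of t > 0 with [p t i j > 0], and suppose that it is
nonempty. Taking [b k = sup P(i, k)] in the second principle shows that P(i, j)
is unbounded ([positivity_unbounded]). Taking [b k = inf (P(i, k) `&` ]t, oo[)]
in the first one shows that P(i, j) has elements just above any t >= 0, so it is
dense ([positivity_dense]). Finally, given t > 0, choose k such that P(i, k)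
meets (0, t) and P(k, j) is nonempty. Then t - P(k, j) is dense in (0, t), so it
meets the open set P(i, k), and t belongs to P(i, j) ([positivity_spreads]). *)

(** * Nonnegative matrix semigroups with continuous entries *)

Record continuous_matrix_semigroup (R : realType)
    (p : R -> nat -> nat -> R) : Prop := {
  matrix_ge0 : forall t i j, 0 < t -> 0 <= p t i j;
  matrix_mul : forall s t i j, 0 < s -> 0 < t ->
    (\sum_(0 <= k <oo) (p s i k * p t k j)%:E = (p (s + t) i j)%:E)%E;
  matrix_continuous : forall i j t, 0 < t ->
    {for t, continuous (fun s => p s i j)}
}.

Section MatrixSemigroup.
Context {R : realType} {p : R -> nat -> nat -> R}.
Context (p_semigroup : continuous_matrix_semigroup R p).
Implicit Types (s t T h c e : R) (f g b : nat -> R) (i j k l : nat).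

Let p_ge0 t i j : 0 < t -> 0 <= p t i j.
Proof. exact: matrix_ge0. Qed.

Lemma matrix_gt0_mul s t i j k :
  0 < s -> 0 < t -> 0 < p s i k -> 0 < p t k j -> 0 < p (s + t) i j.
Proof.
move=> s0 t0 ik kj; rewrite -lte_fin -(matrix_mul _ _ p_semigroup)//.
apply: (@lt_le_trans _ _ (\sum_(0 <= l < k.+1) (p s i l * p t l j)%:E)%E).
  rewrite big_nat_recr//= sumEFin -EFinD lte_fin ltr_wpDl ?mulr_gt0//.
  by apply: sumr_ge0 => l _; rewrite mulr_ge0 ?p_ge0.
by apply: nneseries_lim_ge => l _ _; rewrite lee_fin mulr_ge0 ?p_ge0.
Qed.

Lemma matrix_gt0_split s t i j : 0 < s -> 0 < t -> 0 < p (s + t) i j ->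
  exists2 k, 0 < p s i k & 0 < p t k j.
Proof.
move=> s0 t0; rewrite -lte_fin -(matrix_mul _ _ p_semigroup)// => sum_gt0.
apply: contrapT => none; move: sum_gt0; rewrite eseries0 ?ltxx// => k _ _.
have := p_ge0 s i k s0; rewrite le_eqVlt => /predU1P[<-|ik].
  by rewrite mul0r.
have := p_ge0 t k j t0; rewrite le_eqVlt => /predU1P[<-|kj].
  by rewrite mulr0.
by case: none; exists k.
Qed.

(** * Averages along a path from i to j *)

(** Integral of [f] against the unnormalised law at time [s] of a path from [i]
to [j] of length [T]. It is taken in [\bar R] so that nonnegative [f] raise no
question of summability. *)
Definition mean i j T s (f : nat -> R) : \bar R :=
  (\sum_(0 <= k <oo) (p s i k * p (T - s) k j * f k)%:E)%E.

Let weight_ge0 i j T s k : 0 < s < T -> 0 <= p s i k * p (T - s) k j.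
Proof.
by move=> /andP[s0 sT]; rewrite mulr_ge0 ?p_ge0// subr_gt0.
Qed.

Let mean_term_ge0 i j T s f (P : pred nat) (n : nat) : 0 < s < T ->
  (forall k, 0 <= f k) ->
  forall k, (n <= k)%N -> P k -> (0 <= (p s i k * p (T - s) k j * f k)%:E)%E.
Proof.
by move=> sT f0 k _ _; rewrite lee_fin mulr_ge0 ?weight_ge0.
Qed.

Lemma mean_ge0 i j T s f : 0 < s < T -> (forall k, 0 <= f k) ->
  (0 <= mean i j T s f)%E.
Proof. by move=> sT f0; apply: nneseries_ge0; exact: mean_term_ge0. Qed.

Lemma meanD i j T s f g : 0 < s < T ->
  (forall k, 0 <= f k) -> (forall k, 0 <= g k) ->
  (mean i j T s (fun k => f k + g k)%R = mean i j T s f + mean i j T s g)%E.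
Proof.
move=> sT f0 g0; rewrite /mean -nneseriesD; try exact: mean_term_ge0.
by apply: eq_eseriesr => k _; rewrite mulrDr EFinD.
Qed.

Lemma meanZ i j T s c f : 0 < s < T -> (forall k, 0 <= f k) ->
  (mean i j T s (fun k => c * f k)%R = c%:E * mean i j T s f)%E.
Proof.
move=> sT f0; rewrite /mean -nneseriesZl; last first.
  by move=> k _; apply: (mean_term_ge0 _ _ _ _ _ xpredT 0).
by apply: eq_eseriesr => k _; rewrite -EFinM mulrCA.
Qed.

(** The total mass of the law does not depend on [s]; this is what allows
different times to be compared. *)
Lemma mean_cst i j T s c : 0 < s < T ->
  (mean i j T s (fun=> c) = (c * p T i j)%:E)%E.
Proof.
move=> /andP[s0 sT].
rewrite -[in RHS](subrKC s T) EFinM -(matrix_mul _ _ p_semigroup) ?subr_gt0//.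
rewrite /mean -nneseriesZl; last first.
  by move=> k _; rewrite lee_fin weight_ge0// s0.
by apply: eq_eseriesr => k _; rewrite -EFinM mulrC.
Qed.

Lemma le_mean i j T s f g : 0 < s < T -> (forall k, 0 <= f k) ->
  (forall k, 0 < p s i k -> 0 < p (T - s) k j -> f k <= g k) ->
  (mean i j T s f <= mean i j T s g)%E.
Proof.
move=> sT f0 fg; apply: lee_nneseries; first exact: mean_term_ge0.
move=> k _; rewrite lee_fin.
have [s0 Ts] : 0 < s /\ 0 < T - s by rewrite subr_gt0; apply/andP.
have := p_ge0 s i k s0; rewrite le_eqVlt => /predU1P[<-|ik].
  by rewrite !mul0r.
have := p_ge0 (T - s) k j Ts; rewrite le_eqVlt => /predU1P[<-|kj].
  by rewrite mulr0 !mul0r.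
by rewrite ler_wpM2l ?fg// mulr_ge0 ?ltW.
Qed.

(** Both laws are marginals of the joint law of the states at times [s] and
[s + h], with masses [p s i k * p h k l * p (T - (s + h)) l j]. An inequality
that holds for every possible transition can therefore be integrated. Test
functions of both times are allowed on either side to avoid subtractions in
[\bar R]. *)
Lemma le_mean2 i j T s h (f g f' g' : nat -> R) :
  0 < s -> 0 < h -> s + h < T ->
  (forall k, 0 <= f k) -> (forall k, 0 <= g k) ->
  (forall k, 0 <= f' k) -> (forall k, 0 <= g' k) ->
  (forall k l, 0 < p s i k -> 0 < p h k l -> 0 < p (T - (s + h)) l j ->
    f k + f' l <= g k + g' l) ->
  (mean i j T s f + mean i j T (s + h) f' <=
   mean i j T s g + mean i j T (s + h) g')%E.
Proof.
move=> s0 h0 shT f0 g0 f'0 g'0 fg.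
have Tsh : 0 < T - (s + h) by rewrite subr_gt0.
(* Joint mass of state [k] at time [s] and state [l] at time [s + h]. *)
pose J k l := p s i k * (p h k l * p (T - (s + h)) l j).
have J0 k l : 0 <= J k l by rewrite !mulr_ge0 ?p_ge0.
have meanl u : (forall k, 0 <= u k) -> mean i j T s u =
    (\sum_(0 <= k <oo) \sum_(0 <= l <oo) (J k l * u k)%:E)%E.
  move=> u0; apply: eq_eseriesr => k _.
  rewrite -mulrA mulrCA EFinM (_ : T - s = h + (T - (s + h))); last by lra.
  rewrite -(matrix_mul _ _ p_semigroup)// muleC.
  rewrite -nneseriesZl; last first.
    by move=> l _; rewrite lee_fin mulr_ge0 ?p_ge0.
  by apply: eq_eseriesr => l _; rewrite -EFinM /J; congr EFin; ring.
have meanr u : (forall k, 0 <= u k) -> mean i j T (s + h) u =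
    (\sum_(0 <= k <oo) \sum_(0 <= l <oo) (J k l * u l)%:E)%E.
  move=> u0; rewrite (nneseries_interchange xpredT xpredT); last first.
    by move=> k l; rewrite lee_fin mulr_ge0.
  apply: eq_eseriesr => l _.
  rewrite -mulrA EFinM -(matrix_mul _ _ p_semigroup)// muleC.
  rewrite -nneseriesZl; last first.
    by move=> k _; rewrite lee_fin mulr_ge0 ?p_ge0.
  by apply: eq_eseriesr => k _; rewrite -EFinM /J; congr EFin; ring.
have meanD2 u v : (forall k, 0 <= u k) -> (forall k, 0 <= v k) ->
    (mean i j T s u + mean i j T (s + h) v =
     \sum_(0 <= k <oo) \sum_(0 <= l <oo) (J k l * (u k + v l))%:E)%E.
  move=> u0 v0; rewrite meanl// meanr// -nneseriesD.
  - apply: eq_eseriesr => k _; rewrite -nneseriesD.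
    + by apply: eq_eseriesr => l _; rewrite mulrDr EFinD.
    + by move=> l _ _; rewrite lee_fin mulr_ge0.
    + by move=> l _ _; rewrite lee_fin mulr_ge0.
  - by move=> k _ _; apply: nneseries_ge0 => l _ _; rewrite lee_fin mulr_ge0.
  - by move=> k _ _; apply: nneseries_ge0 => l _ _; rewrite lee_fin mulr_ge0.
rewrite !meanD2//; apply: lee_nneseries => [k _ _|k _].
  by apply: nneseries_ge0 => l _ _; rewrite lee_fin mulr_ge0 ?addr_ge0.
apply: lee_nneseries => [l _ _|l _].
  by rewrite lee_fin mulr_ge0 ?addr_ge0.
rewrite lee_fin; have := J0 k l; rewrite le_eqVlt => /predU1P[<-|Jkl].
  by rewrite !mul0r.
rewrite ler_pM2l//; apply: fg; rewrite lt0r ?p_ge0// andbT;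
  by apply: contraTneq Jkl => z; rewrite /J z ?(mul0r, mulr0) ltxx.
Qed.

Lemma weight_continuous i j T s k : 0 < s < T ->
  {for s, continuous (fun u => p u i k * p (T - u) k j)}.
Proof.
move=> /andP[s0 sT]; apply: cvgM; first exact: matrix_continuous.
apply: (@cvg_comp _ _ _ (fun u => T - u) (fun u => p u k j) _ (nbhs (T - s))).
  by apply: cvgB; [exact: cvg_cst | exact: cvg_id].
by apply: matrix_continuous => //; rewrite subr_gt0.
Qed.

(** A bound from below on a finite partial sum bounds the remaining mass, because
the total is known. *)
Lemma mean_tail i j T s e N : 0 < s < T ->
  p T i j - e <= \sum_(0 <= k < N) p s i k * p (T - s) k j ->
  (mean i j T s (fun k => (N <= k)%:R) <= e%:E)%E.
Proof.
move=> sT eN; have := mean_cst i j T s 1 sT.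
have -> : (fun=> 1) = (fun k => (k < N)%:R + (N <= k)%:R) :> (nat -> R).
  by apply/funext => k; rewrite ltnNge; case: leqP => _; rewrite ?addr0 ?add0r.
rewrite meanD// mul1r => total.
have head : ((p T i j - e)%:E <= mean i j T s (fun k => (k < N)%:R))%E.
  apply: (@le_trans _ _ (\sum_(0 <= k < N)
      (p s i k * p (T - s) k j * (k < N)%:R)%:E)%E).
    rewrite sumEFin lee_fin (le_trans eN)// le_eqVlt.
    apply/orP; left; apply/eqP.
    by apply: eq_big_nat => k /andP[_ ->]; rewrite mulr1.
  by apply: nneseries_lim_ge => k _ _; rewrite lee_fin mulr_ge0 ?weight_ge0.
rewrite -(@leeD2rE _ (p T i j - e)%:E)// -EFinD subrKC -total addeC.
by rewrite leeD2r.
Qed.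

(** Dini's argument: at each time some partial sum exceeds the total minus [e],
it still does at nearby times and for larger [N], and finitely many such
neighbourhoods cover the segment. *)
Lemma uniform_mean_tail i j T s1 s2 e : 0 < s1 -> s2 < T -> 0 < e ->
  exists N : nat, forall s, s1 <= s <= s2 ->
    (mean i j T s (fun k => (N <= k)%:R) <= e%:E)%E.
Proof.
move=> s10 s2T e0.
have [|N _ HN] := (compact_near_coveringP _).1 (@segment_compact R s1 s2)
    nat \oo (fun N s => (mean i j T s (fun k => (N <= k)%:R) <= e%:E)%E) _;
  last first.
  by exists N => s sT; apply: (HN N) => //=; rewrite in_itv.
move=> s /=; rewrite in_itv/= => /andP[s1s ss2].
have sT : 0 < s < T by rewrite (lt_le_trans s10)//= (le_lt_trans ss2).
have [n nP] : exists n, p T i j - e < \sum_(0 <= k < n) p s i k * p (T - s) k j.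
  apply: contrapT => /forallNP Hn.
  have [s0 Ts] : 0 < s /\ 0 < T - s by rewrite subr_gt0; apply/andP.
  have : ((p T i j)%:E <= (p T i j - e)%:E)%E.
    rewrite -[X in ((p X i j)%:E <= _)%E](subrKC s T).
    rewrite -(matrix_mul _ _ p_semigroup)//; apply: lime_le.
      by apply: is_cvg_nneseries => k _ _; rewrite lee_fin weight_ge0.
    by near=> n; rewrite sumEFin lee_fin leNgt; apply/negP; exact: Hn.
  by rewrite lee_fin leNgt gtrBl e0.
have cont : {for s, continuous (fun u =>
    \sum_(0 <= k < n) p u i k * p (T - u) k j)}.
  apply: cvg_big => [|k _]; [exact: add_continuous|exact: weight_continuous].
have near_s : \forall u \near s, [/\ 0 < u < T &
    p T i j - e < \sum_(0 <= k < n) p u i k * p (T - u) k j].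
  near=> u; split.
    by apply/andP; split; near: u; [apply: lt_nbhsr|apply: lt_nbhsl];
       case/andP: sT.
  by near: u; apply: (cvgr_gt _ cont).
exists ([set u | [/\ 0 < u < T &
    p T i j - e < \sum_(0 <= k < n) p u i k * p (T - u) k j]],
  [set N | (n <= N)%N]); first by split=> //; exists n.
move=> [u N] /= [[uT un] nN]; apply: mean_tail => //.
apply: (le_trans (ltW un)); rewrite (big_cat_nat _ nN)//= lerDl.
by apply: sumr_ge0 => k _; exact: weight_ge0.
Unshelve. all: by end_near. Qed.

(** * Functions that drift along the path *)

Lemma finite_gap b (N : nat) : exists2 d : R, 0 < d &
  forall k l, (k < N)%N -> (l < N)%N -> b k < b l -> d < b l - b k.
Proof.
have near_gap : \forall d \near 0^'+, forall x : 'I_N * 'I_N,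
    b x.1 < b x.2 -> d < b x.2 - b x.1.
  apply: filter_forall => x; have [bx|_] := ltP (b x.1) (b x.2).
    by near=> d => _; near: d; apply: nbhs_right_lt; rewrite subr_gt0.
  by near=> d.
have : \forall d \near 0^'+, 0 < d /\ forall x : 'I_N * 'I_N,
    b x.1 < b x.2 -> d < b x.2 - b x.1.
  near=> d; split; last by near: d.
  by near: d; exact: nbhs_right_gt.
move=> /(@filter_ex _ _ _) [d [d0 gap]]; exists d => // k l kN lN bkl.
exact: (gap (Ordinal kN, Ordinal lN)).
Unshelve. all: by end_near. Qed.

(** A slow drift is no drift. On states below [N] the function [b] has a smallest
gap [d], so in a time [h < d] it cannot grow while going from one such state to
another. Growth, at most [h], thus happens only on a mass at most [c], and [n]
steps with [n * h = s2 - s1] add up to at most [(s2 - s1) * c], where [c] is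
arbitrarily small. *)
Lemma mean_nonincreasing i j T s1 s2 b :
  0 < s1 -> s1 < s2 -> s2 < T -> (forall k, 0 <= b k) ->
  (forall s h k l, s1 <= s -> 0 < h -> 0 < p s i k -> 0 < p h k l ->
    b l <= b k + h) ->
  (mean i j T s2 b <= mean i j T s1 b)%E.
Proof.
move=> s10 s12 s2T b0 drift; apply/lee_addgt0Pr => e e0.
pose c := e / (s2 - s1).
have c0 : 0 < c by rewrite divr_gt0// subr_gt0.
have c20 : 0 < c / 2 by rewrite divr_gt0.
have [N tail] := uniform_mean_tail i j T s1 s2 _ s10 s2T c20.
have [d d0 gap] := finite_gap b N.
have step s h : s1 <= s -> 0 < h < d -> s + h <= s2 ->
    (mean i j T (s + h) b <= mean i j T s b + (h * c)%:E)%E.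
  move=> s1s /andP[h0 hd] shs2.
  have s0 : 0 < s by lra.
  have shT' : s + h < T by lra.
  have sT : 0 < s < T by apply/andP; split; lra.
  have shT : 0 < s + h < T by apply/andP; split; lra.
  pose out k : R := (N <= k)%:R.
  have out0 k : 0 <= h * out k by rewrite mulr_ge0 ?(ltW h0).
  have tail_s : (mean i j T s out <= (c / 2)%:E)%E by apply: tail; lra.
  have tail_sh : (mean i j T (s + h) out <= (c / 2)%:E)%E by apply: tail; lra.
  (* A state outside the finite set at either end pays for the growth [h]. *)
  have jump k l : 0 < p s i k -> 0 < p h k l -> 0 < p (T - (s + h)) l j ->
      0 + b l <= b k + h * out k + h * out l.
    move=> ik kl _; have := drift s h k l s1s h0 ik kl.
    rewrite add0r /out; case: leqP => kN; case: leqP => lN /=; try by lra.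
    rewrite mulr0 !addr0 => blk; rewrite leNgt; apply/negP => bkl.
    by have := gap k l kN lN bkl; lra.
  have := @le_mean2 i j T s h (fun=> 0) (fun k => b k + h * out k) b
    (fun k => h * out k).
  rewrite mean_cst// mul0r add0e meanD// !meanZ// => le2.
  apply: (le_trans (le2 _ _ _ _ _ _ _ _)) => //.
  - by move=> k; rewrite addr_ge0.
  - rewrite -addeA leeD2l//.
    rewrite [X in (_ <= X%:E)%E](_ : _ = h * (c / 2) + h * (c / 2)).
      by rewrite EFinD !EFinM leeD// lee_pmul2l// lte_fin.
    by rewrite -mulrDr -splitr.
have [n nP] : exists n : nat, (s2 - s1) / d < n%:R.
  exists (Num.bound ((s2 - s1) / d)); apply: archi_boundP.
  by rewrite divr_ge0 ?ltW// subr_gt0.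
have n0 : (0 : R) < n%:R.
  by apply: lt_trans nP; rewrite divr_gt0// subr_gt0.
pose h := (s2 - s1) / n%:R.
have h0 : 0 < h by rewrite divr_gt0// subr_gt0.
have hd : h < d by rewrite ltr_pdivrMr// mulrC -ltr_pdivrMr.
have nh : n%:R * h = s2 - s1 by rewrite mulrC divfK// gt_eqF.
have iter m : (m <= n)%N ->
    (mean i j T (s1 + m%:R * h) b <= mean i j T s1 b + (m%:R * h * c)%:E)%E.
  elim: m => [_|m IH mn]; first by rewrite !mul0r addr0 adde0.
  have mh0 : 0 <= m%:R * h by rewrite mulr_ge0 ?(ltW h0).
  have mhn : m.+1%:R * h <= s2 - s1.
    by rewrite -nh ler_wpM2r ?(ltW h0)// ler_nat.
  rewrite -natr1 mulrDl mul1r in mhn *.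
  rewrite addrA (le_trans (step _ _ _ _ _))//; [by lra|by rewrite h0|by lra|].
  by rewrite mulrDl EFinD addeA leeD2r// IH// ltnW.
have := iter n (leqnn n); rewrite nh subrKC => /le_trans; apply.
by rewrite leeD2l// lee_fin mulrC divfK// subr_eq0 gt_eqF.
Qed.

(** Between two states below [N] strict growth means growth by at least the
smallest gap [d], however short the step. At least half of the mass [p T i j]
is on such states at both ends of a step, since each end misses at most a
quarter. Hence [n] steps raise the average of [b] by [n * d * p T i j / 2],
with [d] independent of [n]. *)
Lemma strictly_increasing_unbounded i j T s1 s2 b M :
  0 < s1 -> s1 < s2 -> s2 < T -> 0 < p T i j -> (forall k, 0 <= b k) ->
  (forall s k, s1 <= s <= s2 -> 0 < p s i k -> 0 < p (T - s) k j ->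
    b k <= M) ->
  (forall s h k l, s1 <= s -> 0 < h -> s + h <= s2 ->
    0 < p s i k -> 0 < p h k l -> 0 < p (T - (s + h)) l j -> b k < b l) ->
  False.
Proof.
move=> s10 s12 s2T pT b0 bM incr.
have e0 : 0 < p T i j / 4 by lra.
have [N tail] := uniform_mean_tail i j T s1 s2 _ s10 s2T e0.
have [d d0 gap] := finite_gap b N.
have step s h : s1 <= s -> 0 < h -> s + h <= s2 ->
    (mean i j T s b + (d * (p T i j / 2))%:E <= mean i j T (s + h) b)%E.
  move=> s1s h0 shs2.
  have s0 : 0 < s by lra.
  have shT' : s + h < T by lra.
  have sT : 0 < s < T by apply/andP; split; lra.
  have shT : 0 < s + h < T by apply/andP; split; lra.
  pose out k : R := (N <= k)%:R.
  have out0 k : 0 <= d * out k by rewrite mulr_ge0 ?(ltW d0).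
  have tail_s : (mean i j T s out <= (p T i j / 4)%:E)%E by apply: tail; lra.
  have tail_sh : (mean i j T (s + h) out <= (p T i j / 4)%:E)%E.
    by apply: tail; lra.
  (* A state outside the finite set at either end pays for the missing [d]. *)
  have jump k l : 0 < p s i k -> 0 < p h k l -> 0 < p (T - (s + h)) l j ->
      b k + d + 0 <= d * out k + (b l + d * out l).
    move=> ik kl lj; have := incr s h k l s1s h0 shs2 ik kl lj.
    rewrite addr0 /out; case: leqP => kN; case: leqP => lN /=; try by lra.
    by move=> bkl; have := gap k l kN lN bkl; lra.
  have := @le_mean2 i j T s h (fun k => b k + d) (fun k => d * out k) (fun=> 0)
    (fun k => b k + d * out k).
  rewrite mean_cst// mul0r adde0 !meanD// ?mean_cst// ?meanZ//;
    try by move=> _; exact: ltW.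
  move=> le2.
  rewrite -(@leeD2rE _ (d * (p T i j / 2))%:E)// -addeA -EFinD.
  rewrite (_ : _ + _ = d * p T i j); last first.
    by rewrite -mulrDr -splitr.
  apply: (le_trans (le2 _ _ _ _ _ _ _ _)) => //.
  - by move=> k; rewrite addr_ge0 ?(ltW d0).
  - by move=> k; rewrite addr_ge0.
  - rewrite addeCA leeD2l// (_ : d * _ = d * (p T i j / 4) + d * (p T i j / 4)).
      by rewrite EFinD !EFinM leeD// lee_pmul2l// lte_fin.
    by rewrite -mulrDr; congr (_ * _); clear le2; lra.
have bounded : (mean i j T s2 b <= (M * p T i j)%:E)%E.
  have s2T' : 0 < s2 < T by apply/andP; split; lra.
  rewrite -(mean_cst i j T s2)//; apply: le_mean => // k; apply: bM.
  by rewrite lexx ltW.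
have [n nP] : exists n : nat, `|2 * M / d| < n%:R.
  by exists (Num.bound `|2 * M / d|); apply: archi_boundP.
have n0 : (0 : R) < n%:R by apply: le_lt_trans nP.
pose h := (s2 - s1) / n%:R.
have h0 : 0 < h by rewrite divr_gt0// subr_gt0.
have nh : n%:R * h = s2 - s1 by rewrite mulrC divfK// gt_eqF.
have iter m : (m <= n)%N ->
    ((m%:R * (d * (p T i j / 2)))%:E <= mean i j T (s1 + m%:R * h) b)%E.
  elim: m => [_|m IH mn].
    by rewrite !mul0r mean_ge0//; apply/andP; split; lra.
  have mh0 : 0 <= m%:R * h by rewrite mulr_ge0 ?(ltW h0).
  have mhn : m.+1%:R * h <= s2 - s1.
    by rewrite -nh ler_wpM2r ?(ltW h0)// ler_nat.
  rewrite -natr1 !mulrDl !mul1r in mhn *.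
  rewrite addrA (le_trans _ (step _ _ _ _ _))//; [|by lra|by lra].
  by rewrite EFinD leeD2r// IH// ltnW.
have := le_trans (iter n (leqnn n)); rewrite nh subrKC => /(_ _ bounded).
have nd : 2 * M < n%:R * d.
  by rewrite -ltr_pdivrMr// (le_lt_trans (ler_norm _) nP).
have : 2 * M * (p T i j / 2) < n%:R * d * (p T i j / 2).
  by rewrite ltr_pM2r// divr_gt0.
by rewrite lee_fin; lra.
Qed.

(** * Times at which an entry is positive *)

(** If the times [u] with [p u i j > 0] were bounded, then
[c k = sup {u | p u i k > 0}] would be finite at all states on the path, since
from them [j] can still be reached. A transition of length [h] translates times
by [h], so [c] would grow by at least [h] and yet stay bounded. *)
Lemma positivity_unbounded i j T t : 0 < T -> 0 < p T i j ->
  exists2 u, t < u & 0 < p u i j.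
Proof.
move=> T0 pT; apply: contrapT => none.
have le_t u : 0 < p u i j -> u <= t.
  by move=> pu; rewrite leNgt; apply/negP => tu; apply: none; exists u.
pose times k := [set u : R | 0 < u /\ 0 < p u i k].
pose c k := sup (times k).
have c_ub h k : 0 < h -> 0 < p h k j -> ubound (times k) t.
  move=> h0 kj u [u0 ik].
  by have := le_t _ (matrix_gt0_mul _ _ _ _ _ u0 h0 ik kj); lra.
apply: (@strictly_increasing_unbounded i j T (T / 3) (T / 2) c t) => //.
- by lra.
- by lra.
- by lra.
- move=> k; rewrite /c.
  have [[[u uk] ub]|/sup_out->//] := pselect (has_sup (times k)).
  by case: (uk) => u0 _; rewrite (le_trans (ltW u0))// ub_le_sup.
- move=> s k sT ik kj; apply: ge_sup; first by exists s; split=> //; lra.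
  by apply: c_ub kj; lra.
- move=> s h k l s1 h0 s2 ik kl lj.
  have s0 : 0 < s by lra.
  have Tsh : 0 < T - (s + h) by lra.
  (* The bound keeps [sup] at [l] from falling back on its default value 0. *)
  have l_ub := c_ub _ _ Tsh lj.
  apply: (@lt_le_trans _ _ (c k + h)); first by rewrite ltrDl.
  rewrite -lerBrDr; apply: ge_sup; first by exists s.
  move=> u [u0 iku]; rewrite lerBrDr; apply: ub_le_sup; first by exists t.
  split; first exact: addr_gt0.
  exact: matrix_gt0_mul iku kl.
Qed.

(** With [b k] the infimum of the times [u > t] such that [p u i k > 0], a
transition of length [h] raises [b] by at most [h]. The average of [b] just after
time [t] is at most slightly more than [t], and it does not grow, so at a time
just before [T] there is still a state [k] with [b k] close to [t]. Going from
[k] to [j] takes only the short remaining time. *)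
Lemma positivity_dense i j T t e : 0 < T -> 0 < p T i j -> 0 <= t -> 0 < e ->
  exists2 u, t < u < t + e & 0 < p u i j.
Proof.
move=> T0 pT t0 e0.
have [{T0 pT}T tT pT] := positivity_unbounded i j T t T0 pT.
(* The times t + d and T - d delimit the part of the path that is used, and the
   time produced at the end is below t + 3 * d; a quarter leaves room for both. *)
pose d := Num.min e (T - t) / 4.
have d0 : 0 < d by rewrite divr_gt0// lt_min e0 subr_gt0.
have [de dT] : 4 * d <= e /\ 4 * d <= T - t.
  by rewrite mulrC divfK//; split; rewrite ge_min lexx ?orbT.
pose times k := [set u : R | t < u /\ 0 < p u i k].
pose b k := inf (times k).
have b0 k : 0 <= b k.
  have [ne|] := pselect (times k !=set0); last first.
    by move=> /set0P/negP; rewrite negbK => /eqP e'; rewrite /b e' inf0.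
  by apply: lb_le_inf => // u [tu _]; lra.
have lb k : has_lbound (times k) by exists t => u [tu _]; exact: ltW.
have [k [ik kj bk]] : exists k, [/\ 0 < p (T - d) i k, 0 < p d k j &
    b k < t + 2 * d].
  apply: contrapT => none.
  have sT1 : 0 < t + d < T by apply/andP; split; lra.
  have sT2 : 0 < T - d < T by apply/andP; split; lra.
  (* Chain of averages: t + 2 d <= b at time T - d <= b at time t + d <= t + d. *)
  have : ((t + 2 * d) * p T i j <= (t + d) * p T i j)%R.
    rewrite -lee_fin -(mean_cst i j T _ _ sT2) -(mean_cst i j T _ _ sT1).
    apply: (@le_trans _ _ (mean i j T (T - d) b)).
      apply: le_mean => // [k|k ik kj]; first by lra.
      rewrite leNgt; apply/negP => bk; apply: none; exists k; split => //.
      by rewrite subKr in kj.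
    apply: (@le_trans _ _ (mean i j T (t + d) b)).
      apply: mean_nonincreasing => //; try by lra.
      move=> s h k l s1 h0 ik kl; rewrite -lerBlDr; apply: lb_le_inf.
        by exists s; split=> //; lra.
      move=> u [tu iku]; rewrite lerBlDr; apply: ge_inf => //.
      by split; [lra|apply: matrix_gt0_mul iku kl => //; lra].
    apply: le_mean => // k ik _; apply: ge_inf => //.
    by split=> //; lra.
  by rewrite ler_pM2r//; lra.
have [|u [tu iku] ub] := inf_lt _ bk; first by exists (T - d); split=> //; lra.
exists (u + d); first by apply/andP; split; lra.
by apply: matrix_gt0_mul iku kj => //; lra.
Qed.

(** Going through an intermediate state [k] supplies two sets of times: an open
one, around [s] for [p _ i k], and a dense one, for [p _ k j]. Reflecting the
former, [t - u] runs through an interval in which the latter has an element. *)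
Lemma positivity_spreads i j T t :
  0 < T -> 0 < p T i j -> 0 < t -> 0 < p t i j.
Proof.
move=> T0 pT t0.
pose s := Num.min t T / 2.
have s0 : 0 < s by rewrite divr_gt0// lt_min t0.
have [st sT] : s < t /\ s < T.
  by split; rewrite ltr_pdivrMr// gt_min; apply/orP; [left|right]; lra.
have Ts : 0 < T - s by rewrite subr_gt0.
rewrite -(subrKC s T) in pT.
have [k ik kj] := matrix_gt0_split s (T - s) i j s0 Ts pT.
have near_s : \forall u \near s, 0 < u /\ u < t /\ 0 < p u i k.
  near=> u; split; last split; near: u.
  - exact: lt_nbhsr.
  - exact: lt_nbhsl.
  - exact: (cvgr_gt _ (matrix_continuous _ _ p_semigroup i k s s0)).
have [e /= e0 ball_e] := (nbhs_ballP _ _).1 near_s.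
have [ts tse] : 0 < t - s /\ 0 < e by rewrite subr_gt0.
have [u /andP[tu ue] kju] :=
  positivity_dense k j (T - s) (t - s) e Ts kj (ltW ts) e0.
have [|v0 [vt ikv]] := ball_e (t - u).
  by rewrite /ball/= ltr_norml; apply/andP; split; lra.
rewrite -(subrK u t); apply: matrix_gt0_mul ikv kju => //; lra.
Unshelve. all: by end_near. Qed.

End MatrixSemigroup.

(** * The matrix of a semigroup on a sequence space *)

Section SequenceSpaces.
Context {R : realType} {E : sequenceSpace R}.
Implicit Types (x : elt E) (S : {linear elt E -> elt E}).

Let coord_sum n (x : nat -> elt E) K :
  (\sum_(0 <= k < K) x k : elt E) n = \sum_(0 <= k < K) x k n.
Proof.
elim: K => [|K IH]; first by rewrite !big_nil.
by rewrite !big_nat_recr//= -IH.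
Qed.

Lemma truncationE x K n :
  (\sum_(0 <= k < K) x k *: unit_elt E k : elt E) n =
    if (n < K)%N then x n else 0.
Proof.
rewrite coord_sum.
have coordZ k : (x k *: unit_elt E k : elt E) n = x k * (n == k)%:R.
  rewrite (_ : (x k *: unit_elt E k : elt E) n = x k * unit_vector R k n) //.
  rewrite /unit_vector indicE; case: eqVneq => [->|/eqP nk].
    by rewrite mem_set.
  by rewrite memNset.
under eq_bigr do rewrite coordZ.
case: ltnP => nK.
  rewrite (bigD1_seq n) ?mem_index_iota ?iota_uniq//= eqxx mulr1 big1 ?addr0//.
  by move=> k kn; rewrite eq_sym (negPf kn) mulr0.
rewrite big_nat big1// => k /andP[_ kK].
by rewrite gtn_eqF ?mulr0// (leq_trans kK).
Qed.

(** Only nonnegative [x] are considered, so that [x] itself is the order bound: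
every truncation lies between 0 and [x]. *)
Lemma truncation_order_convergent x : (forall n, 0 <= x n) ->
  order_convergent (fun K => \sum_(0 <= k < K) x k *: unit_elt E k) x.
Proof.
move=> x0; split=> [|n].
  by exists x => K n; rewrite truncationE; case: ifP; rewrite ?normr0// ger0_norm.
apply: cvg_near_cst; near=> K; rewrite truncationE ifT//.
by near: K; exact: nbhs_infty_gt.
Unshelve. all: by end_near. Qed.

Lemma seq_order_continuous_series S x j :
  seq_order_continuous S -> (forall n, 0 <= x n) ->
  \sum_(0 <= k < K) x k * S (unit_elt E k) j @[K --> \oo] --> S x j.
Proof.
move=> Scont x0.
have [_ /(_ j)] := Scont _ _ (truncation_order_convergent x x0).
apply: cvg_trans; apply: near_eq_cvg; near=> K.
rewrite linear_sum coord_sum; apply: eq_bigr => k _.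
by rewrite linearZ.
Unshelve. all: by end_near. Qed.

(** The semigroup law becomes matrix multiplication by expanding
[T t (T s (unit_elt E i))] along the coordinates of [T s (unit_elt E i)]. *)
Lemma continuous_operator_matrix (T : R -> {linear elt E -> elt E}) :
  operator_semigroup T ->
  (forall t, 0 < t -> positive_operator (T t)) ->
  (forall t, 0 < t -> seq_order_continuous (T t)) ->
  (forall i j : nat,
    {within `]0, +oo[, continuous (fun t : R => T t (unit_elt E i) j)}) ->
  continuous_matrix_semigroup R (fun t i j => T t (unit_elt E i) j).
Proof.
move=> Tsg Tpos Toc Tcont.
have unit_ge0 i n : 0 <= unit_elt E i n by rewrite /= /unit_vector indicE.
have T_ge0 t i n : 0 < t -> 0 <= T t (unit_elt E i) n.
  by move=> t0; apply: Tpos.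
split=> [t i j|s t i j s0 t0|i j t t0]; first exact: T_ge0.
- have := seq_order_continuous_series (T t) (T s (unit_elt E i)) j (Toc t t0)
    (fun n => T_ge0 s i n s0).
  (* The matrices act on rows: the first factor belongs to the operator applied
     first. *)
  rewrite addrC Tsg// => cvgS; apply/cvg_lim => //.
  under eq_fun do rewrite sumEFin.
  by apply: cvg_EFin cvgS; apply: nearW.
- have := Tcont i j; rewrite continuous_open_subspace; last exact: interval_open.
  by apply; rewrite inE/= in_itv/= t0.
Qed.

End SequenceSpaces.

(** * The dichotomy *)

Theorem theorem1p2 (R : realType) (E : sequenceSpace R)
    (T : R -> {linear elt E -> elt E})
    (T_semigroup : operator_semigroup T)
    (T_positive : forall t, 0 < t -> positive_operator (T t))
    (T_order_continuous : forall t, 0 < t -> seq_order_continuous (T t))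
    (T_continuous : forall i j : nat,
      {within `]0, +oo[, continuous (fun t : R => T t (unit_elt E i) j)})
    (i j : nat) :
  (forall t, 0 < t -> 0 < T t (unit_elt E i) j) \/
  (forall t, 0 < t -> T t (unit_elt E i) j = 0).
Proof.
have semigroup := continuous_operator_matrix T T_semigroup T_positive
  T_order_continuous T_continuous.
have [[s s0 ps]|none] := pselect (exists2 s, 0 < s & 0 < T s (unit_elt E i) j).
  by left=> t; apply: (positivity_spreads semigroup i j s).
right=> t t0; apply/eqP; rewrite eq_le (matrix_ge0 _ _ semigroup)// andbT.
by rewrite leNgt; apply/negP => pt; apply: none; exists t.
Qed.
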